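(* There exists a constant $c>0$ such that for every $\varepsilon>0$, with $k=\Theta(\log(1/\varepsilon))$, the following holds for distributed $k$-center with $9$ processors: for any randomized distributed algorithm in which each processor communicates at most $cn$ of its points to a coordinator (where $n$ is the number of points a processor receives), and the coordinator outputs a subset of the received points as the solution, there is an input on which, with probability at least $1-\varepsilon$, the output is no better than a $4$-approximation.
   Context: The $k$-center problem on a finite metric space $(X,d)$ asks for a set $A\subseteq X$ of at most $k$ centers minimizing the clustering cost $\max_{x\in X}\min_{a\in A}d(a,x)$. In the distributed setting the input points are split among processors, each of which can compute distances only between its own points and sends a subset of its points to a coordinator, which can compute distances among received points. An output is no better than a $4$-approximation if its clustering cost is at least $4$ times the optimum. *)

(* Defs.v *)
From mathcomp Require Import all_boot all_order all_algebra.
From mathcomp Require Import all_classical all_reals all_analysis.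

Set Implicit Arguments.
Unset Strict Implicit.
Unset Printing Implicit Defensive.

Import Order.TTheory GRing.Theory Num.Theory.
Import numFieldNormedType.Exports.

Local Open Scope ring_scope.

Section KCenter.
Context {R : realType} {X : finType}.

Definition is_metric (dist : X -> X -> R) : Prop :=
  [/\ forall x y, 0 <= dist x y,
      forall x y, dist x y = 0 <-> x = y,
      forall x y, dist x y = dist y x
    & forall x y z, dist x z <= dist x y + dist y z].

(* Extended-real valued, so that an empty set of centers has cost [+oo]. *)
Definition kcenter_cost (dist : X -> X -> R) (A : {set X}) : \bar R :=
  \big[maxe/0%E]_(x : X) \big[mine/+oo%E]_(a in A) (dist a x)%:E.

Definition kcenter_opt (k : nat) (dist : X -> X -> R) : \bar R :=
  \big[mine/+oo%E]_(A : {set X} | (#|A| <= k)%N) kcenter_cost dist A.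

Definition restrict_dist (S : {set X}) (dist : X -> X -> R) (x y : X) : R :=
  if (x \in S) && (y \in S) then dist x y else 0.

End KCenter.

(* The point [(i, j)] is the [j]-th of the [n] points held by processor [i]
   among [m] processors. *)
Definition points (m n : nat) : finType := ('I_m * 'I_n)%type.

Definition local_dist {R : realType} {m n : nat}
    (dist : points m n -> points m n -> R) (i : 'I_m) : 'M[R]_n :=
  \matrix_(j, j') dist (i, j) (i, j').

(* An element of [Omega] is the outcome of all the coin tosses, which the
   processors and the coordinator may share.  [send w i M] is the set of (indices
   of) points sent by processor [i] when its own points have distance matrix
   [M]; [decide w S dist] is the answer of the coordinator when it has received
   the points [S], with [dist] vanishing outside [S]. *)
Record distributed_algorithm (R : realType) (m n : nat) (Omega : Type) :=
  DistributedAlgorithm {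
    send : Omega -> 'I_m -> 'M[R]_n -> {set 'I_n};
    decide : Omega -> {set points m n} -> (points m n -> points m n -> R) ->
      {set points m n} }.

Section Execution.
Context {R : realType} {m n : nat} {Omega : Type}.
Variable alg : distributed_algorithm R m n Omega.

Definition received (dist : points m n -> points m n -> R) (w : Omega) :
    {set points m n} :=
  finset (fun x : points m n => x.2 \in send alg w x.1 (local_dist dist x.1)).

Definition output (dist : points m n -> points m n -> R) (w : Omega) :
    {set points m n} :=
  let S := received dist w in decide alg w S (restrict_dist S dist).

End Execution.

(* A randomized algorithm for [k]-center on [m] processors holding [n] points
   each, in which every processor always sends at most [c * n] of its points. *)
Definition admissible {R : realType} {m n : nat} {d : measure_display}
    {Omega : measurableType d} (c : R) (k : nat)
    (alg : distributed_algorithm R m n Omega) : Prop :=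
  forall dist : points m n -> points m n -> R, is_metric dist ->
    [/\ forall (w : Omega) (i : 'I_m),
          #|send alg w i (local_dist dist i)|%:R <= c * n%:R,
        forall w : Omega, output alg dist w \subset received alg dist w,
        forall w : Omega, (#|output alg dist w| <= k)%N
      & forall A : {set points m n},
          measurable [set w | output alg dist w = A]%classic].

(* Main.v *)
Require Import Defs.
From mathcomp Require Import all_boot all_order all_algebra.
From mathcomp Require Import all_classical all_reals all_analysis.
From mathcomp Require Import measurable_realfun.
From mathcomp Require Import zify ring lra.
Import Order.TTheory GRing.Theory Num.Theory.
Import numFieldNormedType.Exports.
Local Open Scope ring_scope.
Set Implicit Arguments.
Unset Strict Implicit.
Unset Printing Implicit Defensive.

(** Take T = Theta(log (1/e)) copies of a gadget at mutual distance 4, with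
    k = 3T; every processor holds about n/T points of each copy. In a copy, a
    processor only sees points at mutual distance 2. Three hidden points change
    the global picture: one of processor 0 and one of processor 1, which together
    are within 1 of all the ordinary points of all processors, and one isolated
    point of a random processor i >= 2, which is at distance 4 from all ordinary
    points of the other processors. The three hidden points of each copy form a
    solution of cost 1, but they are rarely sent. When they are not, the
    coordinator cannot guess i, and since it can afford only three centers per
    copy on average, it uses no point of processor i with constant probability;
    the isolated point is then at distance 4 from the output. Since the copies are
    independent, all of them are solved with probability exponentially small in T;
    averaging over the coins of the algorithm gives one bad input. If n < T, the
    processors send fewer than k points altogether, and k far-apart locations
    already form a bad input. *)

(** * Certifying a ratio of 4, and averaging over random coins *)

Lemma kcenter_no_better_than_4approx (R : realType) (X : finType)
    (dist : X -> X -> R) (k : nat) (A0 A : {set X}) (x0 : X) :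
  (#|A0| <= k)%N ->
  (forall x, exists2 a, a \in A0 & dist a x <= 1) ->
  (forall a, a \in A -> 4 <= dist a x0) ->
  (4%:E * kcenter_opt k dist <= kcenter_cost dist A)%E.
Proof.
move=> A0k cov far.
have opt1 : (kcenter_opt k dist <= 1%:E)%E.
  apply: (@le_trans _ _ (kcenter_cost dist A0)).
    by apply: bigmin_le_cond.
  apply: bigmax_le => [|x _]; first by rewrite lee_fin.
  have [a aA0 ax] := cov x.
  apply: (@le_trans _ _ (dist a x)%:E); last by rewrite lee_fin.
  by apply: (bigmin_le_cond +oo%E (fun a => (dist a x)%:E)).
apply: (@le_trans _ _ 4%:E).
  by rewrite -[leRHS]mule1 lee_pmul2l ?lte_fin // ltr0n.
apply: (@le_trans _ _ (\big[mine/+oo%E]_(a in A) (dist a x0)%:E)).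
  apply: le_bigmin; first by rewrite leey.
  by move=> a aA; rewrite lee_fin far.
by apply: (le_bigmax 0%E
  (fun x => \big[mine/+oo%E]_(a in A) (dist a x)%:E)).
Qed.

Lemma measurable_finite_preimage (d : measure_display) (T : measurableType d)
    (Y : finType) (f : T -> Y) (Q : set Y) :
  (forall y, measurable [set w | f w = y]%classic) ->
  measurable [set w | Q (f w)]%classic.
Proof.
move=> mf.
have -> : [set w | Q (f w)]%classic =
    (\bigcup_(y in Q) [set w | f w = y])%classic.
  by apply/seteqP; split=> w /= => [Qw|[y Qy ->//]]; exists (f w).
apply: fin_bigcup_measurable => // ; exact: finite_finset.
Qed.

(** Averaging in the style of Yao: if every [P (E i)] exceeded [e], integrating the sum of
    indicators would give more than [e * #|I|], against the pointwise bound. *)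
Lemma exists_prob_le (R : realType) (d : measure_display)
    (T : measurableType d) (P : probability T R) (I : finType)
    (E : I -> set T) (e : R) :
  (0 < #|I|)%N -> (forall i, measurable (E i)) ->
  (forall w, \sum_i \1_(E i) w <= e * #|I|%:R) ->
  exists i, (P (E i) <= e%:E)%E.
Proof.
move=> I0 mE bnd; apply: contrapT => /forallNP PE.
have PE' i : (e%:E < P (E i))%E by rewrite ltNge; apply/negP/PE.
have le1 : (\sum_i P (E i) <= (e * #|I|%:R)%:E)%E.
  have -> : (\sum_i P (E i) = \int[P]_w \sum_i (\1_(E i) w)%:E)%E.
    rewrite ge0_integral_sum //; last first.
      by move=> i; apply/measurable_EFinP; exact: measurable_indic.
    by apply: eq_bigr => i _; rewrite integral_indic // setIT.
  apply: (@le_trans _ _ (\int[P]_w (cst (e * #|I|%:R)%:E w))%E).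
    apply: ge0_le_integral => //.
    - by move=> w _; apply: sume_ge0 => i _; rewrite lee_fin.
    - apply: emeasurable_sum => i; apply/measurable_EFinP.
      exact: measurable_indic.
    - by move=> w _; rewrite sumEFin lee_fin.
  by rewrite integral_cst //= probability_setT mule1.
have /card_gt0P [i0 _] := I0.
have finP i : P (E i) = (fine (P (E i)))%:E.
  by rewrite fineK //; exact: fin_num_measure.
have : \sum_(i : I) e < \sum_i fine (P (E i)).
  apply: ltr_sum => [|i _]; last by rewrite -lte_fin -finP.
  by apply/hasP; exists i0; rewrite ?mem_index_enum.
rewrite sumr_const -mulr_natr ltNge => /negP; apply.
by rewrite -lee_fin -sumEFin -(eq_bigr _ (fun i _ => finP i)).
Qed.

(** * Counting the configurations solved from masked information *)

Section Masking.
Variables (R : realType) (G H : finType) (U : G -> {set H}).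

(** All that a coordinator learns: the values in [U g] are those it cannot tell apart in coordinate
    [g]. *)
Definition mask (h : {ffun G -> H}) : {ffun G -> option H} :=
  [ffun g => if h g \in U g then None else Some (h g)].

(** [Fl mu g] collects values of coordinate [g] on which the answer determined by [mu] fails; in the
    coordinates of [good mu] they have density at least [p]. *)
Variables (succ : pred {ffun G -> H})
  (Fl : {ffun G -> option H} -> G -> {set H})
  (good : {ffun G -> option H} -> {set G}) (p a b : R).
Hypotheses (p_ge0 : 0 <= p) (p_le : p <= 2^-1).
Hypothesis FlU : forall mu g, Fl mu g \subset U g.
Hypothesis Fl_fail :
  forall h g, succ h -> h g \notin Fl (mask h) g.
Hypothesis Fl_big : forall h g, g \in good (mask h) ->
  p * #|H|%:R <= #|Fl (mask h) g|%:R.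
Hypothesis good_big : forall h, a * #|G|%:R <= #|good (mask h)|%:R.
Hypothesis UC_small : \sum_g #|~: U g|%:R <= b * #|G|%:R * #|H|%:R.

Let w g (o : option H) : R :=
  if o is Some x then (x \notin U g)%:R * expR p else #|U g|%:R.

Let fib (mu : {ffun G -> option H}) g : pred H :=
  [pred x | ((if x \in U g then None else Some x) == mu g)
            && (x \notin Fl mu g)].

Let expRp2 : expR p <= 2.
Proof.
rewrite -[p]opprK expRN -[2]invrK lef_pV2 ?posrE ?expR_gt0 ?invr_gt0 //.
apply: le_trans (expR_ge1Dx (- p)); move: p_le.
by rewrite lerBrDr -lerBrDl => /le_trans; apply; lra.
Qed.

(** A visible coordinate has at most one value, and its weight [expR p] absorbs the factor
    [expR (- p)]. A masked good one loses [p * #|H|], hence at least [p * #|U g|], values, and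
    [1 - p <= expR (- p)]. *)
Let fib_card h g : #|fib (mask h) g|%:R <=
  w g (mask h g) * expR (- (p * (g \in good (mask h))%:R)).
Proof.
rewrite /w; case mg : (mask h g) => [x|].
  have -> : x \notin U g.
    by move: mg; rewrite ffunE; case: ifPn => // hU [<-].
  have c1 : (#|fib (mask h) g| <= 1)%N.
    rewrite -(card1 x); apply/subset_leq_card/fintype.subsetP => y.
    by rewrite !inE mg => /andP[]; case: ifP => // _ /eqP[->].
  apply: (@le_trans _ _ 1); first by rewrite lern1.
  rewrite mul1r -expRD -[leLHS]expR0 ler_expR.
  by case: (_ \in _); rewrite ?mulr1 ?mulr0 ?subr0 ?subrr.
have cU : (#|fib (mask h) g| <= #|U g :\: Fl (mask h) g|)%N.
  apply/subset_leq_card/fintype.subsetP => y.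
  by rewrite !inE mg; case: (y \in U g); rewrite //= ?andbT.
apply: (@le_trans _ _ #|U g :\: Fl (mask h) g|%:R); first by rewrite ler_nat.
case: (boolP (g \in _)) => [/Fl_big big|_]; last first.
  rewrite mulr0 oppr0 expR0 mulr1 ler_nat.
  exact/subset_leq_card/subsetDl.
have -> : #|U g :\: Fl (mask h) g|%:R = #|U g|%:R - #|Fl (mask h) g|%:R :> R.
  rewrite cardsD (finset.setIidPr (FlU _ _)) natrB //.
  exact: subset_leq_card.
rewrite mulr1; apply: (@le_trans _ _ (#|U g|%:R * (1 - p))).
  rewrite mulrBr mulr1 lerD2l lerN2; apply: le_trans big.
  by rewrite mulrC ler_wpM2l // ler_nat max_card.
by rewrite ler_wpM2l // expR_ge1Dx.
Qed.

(** The answer, hence [good], is constant on a mask class, so the successes in the class lie in the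
    product of the fibres. *)
Let class_card mu :
  \sum_(h | mask h == mu) (succ h)%:R <=
  expR (- (p * a * #|G|%:R)) * \prod_g w g (mu g).
Proof.
have w0 : 0 <= \prod_g w g (mu g).
  by apply: prodr_ge0 => g _; rewrite /w; case: (mu g) => // x;
     rewrite mulr_ge0 // expR_ge0.
have [[h0 h0mu]|noh] := pselect (exists h, mask h = mu); last first.
  rewrite [leLHS]big_pred0; last first.
    by move=> h; apply/negbTE/negP => /eqP hmu; apply: noh; exists h.
  by rewrite mulr_ge0 // expR_ge0.
have le1 : \sum_(h | mask h == mu) (succ h)%:R <= \prod_g #|fib mu g|%:R :> R.
  rewrite -natr_sum -natr_prod ler_nat.
  have <- : #|family (fib mu)| = (\prod_g #|fib mu g|)%N.
    by rewrite card_family foldrE big_map big_enum.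
  rewrite -big_mkcondr sum1_card; apply/subset_leq_card/fintype.subsetP => h.
  rewrite !inE => /andP[/eqP hmu sh]; apply/familyP => g; rewrite inE.
  by rewrite -{2}hmu Fl_fail // andbT -hmu ffunE.
apply: (le_trans le1); subst mu.
apply: (@le_trans _ _ (\prod_g (w g (mask h0 g) *
    expR (- (p * (g \in good (mask h0))%:R))))).
  by apply: ler_prod => g _; rewrite ler0n fib_card.
rewrite big_split /= mulrC ler_wpM2r // -expR_sum ler_expR.
rewrite sumrN lerN2 -mulr_sumr -natr_sum -mulrA ler_wpM2l //.
by rewrite -big_mkcond sum1_card.
Qed.

(* Group the configurations by their mask. Inside a class each unmasked good
   coordinate costs a factor [1 - p]; the exponential weight [expR p] given to
   masked coordinates compensates for the good coordinates lost to the mask. *)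
Lemma masked_count :
  \sum_h (succ h)%:R <=
  expR ((b - p * a) * #|G|%:R) * #|{ffun G -> H}|%:R.
Proof.
rewrite (partition_big mask predT) //=.
apply: (le_trans (ler_sum _ (fun mu _ => class_card mu))).
(* Summing over all masks, attained or not, lets the sum of products factor over the coordinates. *)
rewrite -mulr_sumr -(bigA_distr_bigA w) /=.
have -> : (b - p * a) * #|G|%:R = - (p * a * #|G|%:R) + b * #|G|%:R by ring.
rewrite expRD -[leRHS]mulrA ler_wpM2l ?expR_ge0 //.
have sumw g : \sum_o w g o <= #|H|%:R + #|~: U g|%:R.
  have -> : \sum_o w g o = #|U g|%:R + #|~: U g|%:R * expR p.
    rewrite (bigD1 None) //=; congr (_ + _).
    rewrite (reindex_omap Some id) => [|[]//].
    under eq_bigl do rewrite eqxx.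
    rewrite /= -mulr_suml -natr_sum -big_mkcond sum1_card.
    by congr (_%:R * _); apply: eq_card => x; rewrite !inE.
  have := cardsC (U g); move/(congr1 (fun n => n%:R : R)).
  rewrite natrD => <-; rewrite -addrA lerD2l.
  by rewrite -mulr2n -[leRHS]mulr_natr ler_wpM2l.
have [H0|Hpos] := posnP #|H|.
  have [G0|Gpos] := posnP #|G|.
    rewrite big_pred0; last by move=> g; move: G0 => /card0_eq/(_ g); rewrite inE.
    by rewrite card_ffun G0 mulr0 expR0 expn0 mul1r.
  have /card_gt0P[g0 _] := Gpos.
  apply: (@le_trans _ _ 0); last by rewrite mulr_ge0 ?expR_ge0.
  rewrite (bigD1 g0) //= (_ : \sum_j _ = 0) ?mul0r //.
  apply/eqP; rewrite eq_le; apply/andP; split.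
    apply: (le_trans (sumw g0)).
    have -> : #|~: U g0| = 0%N.
      by apply/eqP; rewrite -leqn0 -H0 max_card.
    by rewrite H0 addr0.
  by apply: sumr_ge0 => [[x|]] _; rewrite /w // mulr_ge0 ?expR_ge0.
have Hr : 0 < #|H|%:R :> R by rewrite ltr0n.
apply: (@le_trans _ _ (\prod_g (expR (#|~: U g|%:R / #|H|%:R) * #|H|%:R))).
  apply: ler_prod => g _; apply/andP; split.
    by apply: sumr_ge0 => [[x|]] _; rewrite /w // mulr_ge0 ?expR_ge0.
  apply: (le_trans (sumw g)).
  apply: (@le_trans _ _ ((1 + #|~: U g|%:R / #|H|%:R) * #|H|%:R)).
    by rewrite mulrDl mul1r divfK ?gt_eqF.
  by rewrite ler_wpM2r // expR_ge1Dx.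
rewrite big_split /= prodr_const card_ffun natrX ler_wpM2r ?exprn_ge0 //.
rewrite -expR_sum ler_expR -mulr_suml ler_pdivrMr //.
Qed.

End Masking.

(** * Gluing metrics at mutual distance 4 *)

Section Glue.
Variables (X : finType) (G : eqType) (grp : X -> G) (D : G -> X -> X -> nat).

(** The test [x == y] comes first, so [D] may be positive on the diagonal, as [kdist] is for two
    points of the same kind. *)
Definition glue_dist (x y : X) : nat :=
  if x == y then 0%N else if grp x == grp y then D (grp x) x y else 4%N.

Lemma glue_dist_metric (R : realType) :
  (forall g x y, 0 < D g x y <= 4)%N ->
  (forall g x y, D g x y = D g y x) ->
  (forall g x y z, D g x z <= D g x y + D g y z)%N ->
  is_metric (fun x y => (glue_dist x y)%:R : R).
Proof.
move=> Dbnd Dsym Dtri; split=> [x y|x y|x y|x y z].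
- exact: ler0n.
- rewrite /glue_dist; split=> [/eqP|->]; last by rewrite eqxx.
  by rewrite pnatr_eq0; have [//|_] := eqVneq x y; case: ifP => // _;
     have /andP[] := Dbnd (grp x) x y; case: (D (grp x) x y).
- rewrite /glue_dist [y == x]eq_sym [grp y == grp x]eq_sym.
  by case: eqP => // _; case: eqP => // ->; rewrite Dsym.
rewrite -natrD ler_nat /glue_dist.
have [//|xz] := eqVneq x z.
have [<-|xy] := eqVneq x y; first by rewrite (negbTE xz).
have [<-|yz] := eqVneq y z; first by rewrite addn0.
have /andP[_ D4] := Dbnd (grp x) x z.
have [gxy|gxy] := eqVneq (grp x) (grp y); have [gyz|gyz] := eqVneq (grp y) (grp z).
- by rewrite gxy gyz eqxx.
- by rewrite gxy (negbTE gyz) leq_addl.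
- by rewrite -gyz (negbTE gxy) leq_addr.
- by case: ifP => // _; apply: leq_trans D4 _; rewrite leq_addr.
Qed.

End Glue.

(** * The metric of one gadget *)

(* In one copy of the gadget, [K0], [K1], [KI], [KO] are the ordinary points of
   processor 0, processor 1, the random processor, and the other processors;
   [KA], [KB], [KX] are the hidden points of the first three. *)
Inductive kind := K0 | K1 | KI | KO | KA | KB | KX.

Definition special (k : kind) : bool :=
  if k is (KA | KB | KX) then true else false.

(** [KA] stays at distance 2 from [K0], which shares its processor, so [KB] must cover [K0], and
    symmetrically. The value 3 is forced: at most 2 + 1 through [KI], at least 4 - 1 because of
    [KO]. *)
Definition kdist (k1 k2 : kind) : nat :=
  match k1, k2 with
  | KX, (KX | KI) | KI, KX => 2
  | KX, (KA | KB) | (KA | KB), KX => 3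
  | KX, _ | _, KX => 4
  | KA, (K1 | KI | KO) | (K1 | KI | KO), KA => 1
  | KB, (K0 | KI | KO) | (K0 | KI | KO), KB => 1
  | _, _ => 2
  end.

Lemma kdist_bound k1 k2 : (0 < kdist k1 k2 <= 4)%N.
Proof. by case: k1; case: k2. Qed.

Lemma kdistC k1 k2 : kdist k1 k2 = kdist k2 k1.
Proof. by case: k1; case: k2. Qed.

Lemma kdist_triangle k1 k2 k3 : (kdist k1 k3 <= kdist k1 k2 + kdist k2 k3)%N.
Proof. by case: k1; case: k2; case: k3. Qed.

Lemma kdist_ordinary k1 k2 : ~~ special k1 -> ~~ special k2 -> kdist k1 k2 = 2%N.
Proof. by case: k1; case: k2. Qed.

Lemma leq_card_bigcup (I Y : finType) (B : {set I}) (F : I -> {set Y}) :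
  (#|\bigcup_(i in B) F i| <= \sum_(i in B) #|F i|)%N.
Proof.
elim/big_rec2: _ => [|i m A _ leAm]; first by rewrite cards0.
by apply: leq_trans (leq_card_setU _ _) _; rewrite leq_add2l.
Qed.

(** Markov's inequality in counting form. *)
Lemma leq_card_mul_sum (G : finType) (B : {set G}) (v : nat) (m : G -> nat) :
  (forall g, g \in B -> v <= m g)%N -> (v * #|B| <= \sum_g m g)%N.
Proof.
move=> vm; rewrite mulnC -sum_nat_const [leqRHS](bigID (mem B)) /=.
by apply: leq_trans (leq_addr _ _); apply: leq_sum.
Qed.

(** * The hard inputs, their cheap solutions, and what the received points reveal *)

Section HardInstance.
Variables (t n : nat).
Notation T := t.+1.
Notation s := (n %/ T)%N.
Notation X := (points 9 n).
Notation config := ('I_7 * 'I_s)%type.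

(* The [j]-th point of every processor belongs to copy [j %% T], with rank
   [j %/ T]. The configuration [(i, r)] of a copy designates the points of rank
   [r] of processors 0, 1 and [i + 2] as its hidden points. *)
Definition group (x : X) : 'I_T := inord (x.2 %% T).

Definition proc0 : 'I_9 := @Ordinal 9 0 isT.
Definition proc1 : 'I_9 := @Ordinal 9 1 isT.
Definition proc (i : 'I_7) : 'I_9 := rshift 2 i.

Definition kind_of (c : config) (x : X) : kind :=
  let sp := (x.2 %/ T == c.2)%N in
  if x.1 == proc0 then if sp then KA else K0
  else if x.1 == proc1 then if sp then KB else K1
  else if x.1 == proc c.1 then if sp then KX else KI
  else KO.

Definition hard_dist (h : {ffun 'I_T -> config}) : X -> X -> nat :=
  glue_dist group (fun g x y => kdist (kind_of (h g) x) (kind_of (h g) y)).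

Lemma hard_dist_metric (R : realType) h :
  is_metric (fun x y => (hard_dist h x y)%:R : R).
Proof.
apply: glue_dist_metric => *;
  [exact: kdist_bound|exact: kdistC|exact: kdist_triangle].
Qed.

Lemma kdist_same_proc c (x y : X) :
  x.1 = y.1 -> kdist (kind_of c x) (kind_of c y) = 2%N.
Proof. by rewrite /kind_of => ->; do ![case: ifP => _]. Qed.

(** The right-hand side is free of [h]: within a processor each copy shows only distance 2, so for
    fixed coins the messages do not depend on the configuration. *)
Lemma local_hard_dist (R : realType) h (i : 'I_9) :
  local_dist (fun x y => (hard_dist h x y)%:R : R) i =
  \matrix_(j, j') (glue_dist group (fun _ _ _ => 2%N) (i, j) (i, j'))%:R.
Proof.
apply/matrixP => j j'; rewrite !mxE /hard_dist /glue_dist.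
by rewrite kdist_same_proc.
Qed.

Lemma center_proof (g : 'I_T) (r : 'I_s) : (r * T + g < n)%N.
Proof.
apply: (@leq_trans (s * T)); last exact: leq_trunc_div.
apply: (@leq_trans (r.+1 * T)); last by rewrite leq_mul2r ltn_ord orbT.
by rewrite mulSn addnC ltn_add2r.
Qed.

Definition center (l : 'I_9) (g : 'I_T) (r : 'I_s) : X :=
  (l, Ordinal (center_proof g r)).

Lemma group_center l g r : group (center l g r) = g.
Proof. by rewrite /group /= modnMDl modn_small // inord_val. Qed.

Lemma rank_center l g r : ((center l g r).2 %/ T)%N = r.
Proof. by rewrite /= divnMDl // (divn_small (ltn_ord g)) addn0. Qed.

Lemma eq_center (x : X) (r : 'I_s) :
  (x.2 %/ T)%N = r -> x = center x.1 (group x) r.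
Proof.
case: x => l j /= jr; congr (_, _); apply/val_inj => /=.
by rewrite /group inordK ?ltn_mod //= -jr -divn_eq.
Qed.

Definition centers (h : {ffun 'I_T -> config}) : {set X} :=
  [set center proc0 g (h g).2 | g : 'I_T]
  :|: [set center proc1 g (h g).2 | g : 'I_T]
  :|: [set center (proc (h g).1) g (h g).2 | g : 'I_T].

Lemma card_centers h : (#|centers h| <= 3 * T)%N.
Proof.
have im (f : 'I_T -> X) : (#|[set f g | g : 'I_T]| <= T)%N.
  by apply: leq_trans (leq_imset_card _ _) _; rewrite card_ord.
apply: leq_trans (leq_card_setU _ _) _; rewrite !mulSn mul0n addn0 addnA.
by apply: leq_add => //; apply: leq_trans (leq_card_setU _ _) _; apply: leq_add.
Qed.

Lemma kind_center0 c g : kind_of c (center proc0 g c.2) = KA.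
Proof. by rewrite /kind_of rank_center !eqxx. Qed.

Lemma kind_center1 c g : kind_of c (center proc1 g c.2) = KB.
Proof. by rewrite /kind_of rank_center !eqxx. Qed.

Lemma kind_centerX c g : kind_of c (center (proc c.1) g c.2) = KX.
Proof. by rewrite /kind_of rank_center !eqxx. Qed.

(** The hidden point of processor 0 covers the ordinary points of all other processors, that of
    processor 1 covers those of processor 0, and each hidden point covers itself. *)
Lemma centers_cover h (x : X) :
  exists2 a, a \in centers h & (hard_dist h a x <= 1)%N.
Proof.
set c := h (group x).
have c0 : center proc0 (group x) c.2 \in centers h.
  by rewrite !finset.in_setU -orbA; apply/or3P/Or31/imsetP; exists (group x).
have c1 : center proc1 (group x) c.2 \in centers h.
  by rewrite !finset.in_setU -orbA; apply/or3P/Or32/imsetP; exists (group x).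
have cX : center (proc c.1) (group x) c.2 \in centers h.
  by rewrite !finset.in_setU -orbA; apply/or3P/Or33/imsetP; exists (group x).
have near l : (kdist (kind_of c (center l (group x) c.2)) (kind_of c x) <= 1)%N ->
    (hard_dist h (center l (group x) c.2) x <= 1)%N.
  by move=> le1; rewrite /hard_dist /glue_dist group_center eqxx; case: ifP.
have self l : x.1 = l -> (x.2 %/ T == c.2)%N ->
    (hard_dist h (center l (group x) c.2) x <= 1)%N.
  move=> <- /eqP xr; rewrite -(eq_center xr).
  by rewrite /hard_dist /glue_dist eqxx.
have [x0|n0] := eqVneq x.1 proc0.
  have [xr|nr] := boolP (x.2 %/ T == c.2)%N.
    by exists (center proc0 (group x) c.2) => //; apply: self.
  exists (center proc1 (group x) c.2) => //; apply: near.
  by rewrite kind_center1 /kind_of x0 eqxx (negbTE nr).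
have [x1|n1] := eqVneq x.1 proc1.
  have [xr|nr] := boolP (x.2 %/ T == c.2)%N.
    by exists (center proc1 (group x) c.2) => //; apply: self.
  exists (center proc0 (group x) c.2) => //; apply: near.
  by rewrite kind_center0 /kind_of x1 (negbTE nr).
have [xi|ni] := eqVneq x.1 (proc c.1); last first.
  exists (center proc0 (group x) c.2) => //; apply: near.
  by rewrite kind_center0 /kind_of (negbTE n0) (negbTE n1) (negbTE ni).
have [xr|nr] := boolP (x.2 %/ T == c.2)%N.
  by exists (center (proc c.1) (group x) c.2) => //; apply: self.
exists (center proc0 (group x) c.2) => //; apply: near.
by rewrite kind_center0 /kind_of (negbTE n0) (negbTE n1) xi eqxx (negbTE nr).
Qed.

Definition load (S : {set X}) (g : 'I_T) : nat :=
  #|[set x in S | group x == g]|.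

Lemma sum_load (S : {set X}) : (\sum_g load S g = #|S|)%N.
Proof.
rewrite -sum1_card (partition_big group predT) //=.
by apply: eq_bigr => g _; rewrite sum1dep_card.
Qed.

(** Under these configurations all received points of the copy are ordinary, hence pairwise at
    distance 2. *)
Definition unseen (S : {set X}) (g : 'I_T) : {set config} :=
  [set c | [forall x, (x \in S) && (group x == g) ==> ~~ special (kind_of c x)]].

Lemma unseenP (S : {set X}) g c x :
  c \in unseen S g -> x \in S -> group x = g -> ~~ special (kind_of c x).
Proof. by rewrite inE => /forallP/(_ x)/implyP cU xS xg; apply: cU; rewrite xS xg /=. Qed.

Lemma special_rank c (x : X) : special (kind_of c x) -> (x.2 %/ T)%N = c.2.
Proof.
rewrite /kind_of; have [//|_] := eqVneq (x.2 %/ T)%N (c.2 : nat).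
by do ![case: ifP => _].
Qed.

(** Once [i] is fixed, a received point can reveal only the configuration whose rank is its own. *)
Lemma card_seen (S : {set X}) g i :
  (#|[set c in ~: unseen S g | c.1 == i]| <= load S g)%N.
Proof.
pose f x := [set c : config | (c.1 == i) && special (kind_of c x)].
have f1 x : (#|f x| <= 1)%N.
  apply/card_le1_eqP => -[c1 c2] [d1 d2].
  rewrite !inE /= => /andP[/eqP -> /special_rank e1] /andP[/eqP -> /special_rank e2].
  by congr (_, _); apply/val_inj; rewrite /= -e1 -e2.
apply: (@leq_trans (\sum_(x in [set x in S | group x == g]) #|f x|)); last first.
  by rewrite /load -sum1_card; apply: leq_sum.
apply: leq_trans (leq_card_bigcup _ _); apply/subset_leq_card/fintype.subsetP.
move=> c; rewrite !inE negb_forall => /andP[/existsP[x]].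
rewrite negb_imply negbK => /andP[xS sx] ci.
by apply/bigcupP; exists x; rewrite ?inE // ci.
Qed.

Lemma card_seen_all (S : {set X}) g : (#|~: unseen S g| <= 7 * load S g)%N.
Proof.
rewrite -sum1_card (partition_big fst predT) //= -[X in (X * _)%N]card_ord.
rewrite -sum_nat_const; apply: leq_sum => i _.
by rewrite sum1dep_card card_seen.
Qed.

Lemma card_unseen (S : {set X}) g i :
  (s <= #|[set c in unseen S g | c.1 == i]| + load S g)%N.
Proof.
have cs : #|[set c : config | c.1 == i]| = s.
  have -> : [set c : config | c.1 == i] = finset.setX [set i] [set: 'I_s].
    by apply/setP => c; rewrite !inE andbT.
  by rewrite cardsX cards1 cardsT card_ord mul1n.
rewrite -{1}cs; apply: leq_trans (leq_add (leqnn _) (card_seen S g i)).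
apply: leq_trans (leq_card_setU _ _); apply/subset_leq_card/fintype.subsetP => c.
by rewrite !inE => ->; rewrite !andbT orbN.
Qed.

(** Pigeonhole: six centers cannot meet all seven candidate processors. *)
Lemma exists_unused_proc (A : {set X}) g : (load A g <= 6)%N ->
  exists i, forall x, x \in A -> group x = g -> x.1 != proc i.
Proof.
move=> A6; apply: contrapT => /forallNP noi.
suff : (7 <= load A g)%N by rewrite leqNgt ltnS A6.
rewrite -[leqLHS]card_ord -(card_imset _ (@rshift_inj 2 7)) /load.
apply: leq_trans (leq_imset_card fst _).
apply/subset_leq_card/fintype.subsetP => _ /imsetP[i _ ->].
have /existsNP[x /not_implyP[xA /not_implyP[xg /negP]]] := noi i.
by rewrite negbK => /eqP xi; apply/imsetP; exists x; rewrite ?inE ?xA ?xg //= xi.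
Qed.

End HardInstance.

(** * The coordinator against a random configuration, with coins and received points fixed *)

Section Coordinator.
Variables (R : realType) (t n : nat).
Notation T := t.+1.
Notation s := (n %/ T)%N.
Notation X := (points 9 n).
Notation config := ('I_7 * 'I_s)%type.
Variables (S : {set X}) (dec : (X -> X -> R) -> {set X}).

Let answer (h : {ffun 'I_T -> config}) : {set X} :=
  dec (restrict_dist S (fun x y => (hard_dist h x y)%:R)).

Hypothesis T_le_n : (T <= n)%N.
Hypothesis S_small : (80 * #|S| <= n)%N.
Hypothesis answer_sub : forall h, answer h \subset S.
Hypothesis answer_card : forall h, (#|answer h| <= 3 * T)%N.

(** The received distances rebuilt from the mask alone, with 2 throughout each masked copy. *)
Let masked_dist (mu : {ffun 'I_T -> option config}) (x y : X) : R :=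
  if (x \in S) && (y \in S) then
    (glue_dist (@group t n) (fun g x y =>
       if mu g is Some c then kdist (kind_of c x) (kind_of c y) else 2%N) x y)%:R
  else 0.

Let unused (A : {set X}) (g : 'I_T) : {set config} :=
  [set c in unseen S g |
    [forall x, (x \in A) && (group t x == g) ==> (x.1 != proc c.1)]].

Let good (A : {set X}) : {set 'I_T} :=
  [set g | (load A g <= 6)%N && (2 * load S g <= s)%N].

Let restrict_masked h :
  restrict_dist S (fun x y => (hard_dist h x y)%:R) =
  masked_dist (mask (unseen S) h).
Proof.
apply/funext => x; apply/funext => y; rewrite /restrict_dist /masked_dist.
case: ifP => // /andP[xS yS]; congr (_%:R).
rewrite /hard_dist /glue_dist ffunE; case: ifP => // _; case: eqP => // gxy.
case: ifP => // hU; apply: kdist_ordinary; first exact: unseenP hU xS _.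
by apply: unseenP hU yS _.
Qed.

Let answerE h : answer h = dec (masked_dist (mask (unseen S) h)).
Proof. by rewrite /answer restrict_masked. Qed.

Let s_gt0 : (0 < s)%N.
Proof. by rewrite divn_gt0. Qed.

(** As [s >= 1], [n < (s + 1) * T <= 2 * s * T]; the rounding in [s] costs the factor from 80 to
    40. *)
Let S_small_s : (40 * #|S| <= s * T)%N.
Proof.
have nE := divn_eq n T; have := ltn_pmod n (ltn0Sn t).
by have := S_small; have := s_gt0; nia.
Qed.

(** At most [3T/7] copies contain 7 or more centers and at most [T/20] have at least [s/2] received
    points; this leaves more than [T/2]. *)
Let card_good (A : {set X}) : (#|A| <= 3 * T)%N -> (T <= 2 * #|good A|)%N.
Proof.
move=> A3.
pose bad1 := [set g : 'I_T | (7 <= load A g)%N].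
pose bad2 := [set g : 'I_T | (s <= 2 * load S g)%N].
have b1 : (7 * #|bad1| <= #|A|)%N.
  by rewrite -(sum_load t A); apply: leq_card_mul_sum => g; rewrite inE.
have b2 : (s * #|bad2| <= 2 * #|S|)%N.
  rewrite -(sum_load t S) big_distrr /=.
  by apply: leq_card_mul_sum => g; rewrite inE.
have cov : (T <= #|good A| + #|bad1| + #|bad2|)%N.
  rewrite -[leqLHS](card_ord T) -cardsT.
  apply: leq_trans (leq_trans (leq_card_setU _ _)
    (leq_add (leq_card_setU _ _) (leqnn _))).
  apply/subset_leq_card/fintype.subsetP => g _; rewrite !inE.
  lia.
have b2' : (20 * #|bad2| <= T)%N.
  by rewrite -(leq_pmul2l s_gt0); have := S_small_s; nia.
lia.
Qed.

Let card_unused (A : {set X}) g : g \in good A -> (s <= 2 * #|unused A g|)%N.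
Proof.
rewrite inE => /andP[/exists_unused_proc[i iP] Sg].
have le1 : (#|[set c in unseen S g | c.1 == i]| <= #|unused A g|)%N.
  apply/subset_leq_card/fintype.subsetP => c.
  rewrite !inE => /andP[-> /eqP ->] /=.
  by apply/forallP => x; apply/implyP => /andP[xA /eqP xg]; apply: iP.
have := card_unseen S g i; lia.
Qed.

Lemma hard_count :
  \sum_(h : {ffun 'I_T -> config})
     ([forall x, exists a in answer h, hard_dist h a x < 4]%N)%:R <=
  expR (- (T%:R / 100)) * #|{ffun 'I_T -> config}|%:R :> R.
Proof.
pose Fl mu g := unused (dec (masked_dist mu)) g.
pose gd mu := good (dec (masked_dist mu)).
have cardH : #|{: config}| = (7 * s)%N by rewrite card_prod !card_ord.
(* Here [b = 1/40], [p = 1/14] (half of the ranks for one of 7 processors) and [a = 1/2];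
   [1/40 - 1/28 = -3/280] is below [-1/100]. *)
apply: (@le_trans _ _ (expR ((40^-1 - 14^-1 * 2^-1) * #|'I_T|%:R)
                       * #|{ffun 'I_T -> config}|%:R)); last first.
  rewrite ler_wpM2r // ler_expR card_ord.
  have : 0 <= T%:R :> R by [].
  lra.
apply: (@masked_count _ _ _ (unseen S) _ Fl gd).
- by rewrite invr_ge0.
- by rewrite lef_pV2 ?posrE // ler_nat.
- by move=> mu g; apply/fintype.subsetP => c; rewrite inE => /andP[].
- move=> h g /forallP succ; apply/negP; rewrite inE -answerE.
  move=> /andP[hU /forallP noA].
  have /existsP[a /andP[aA]] := succ (center (proc (h g).1) g (h g).2).
  have aS := fintype.subsetP (answer_sub h) a aA.
  rewrite /hard_dist /glue_dist group_center.
  have [ga|ga] := eqVneq (group t a) g; last first.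
    by have [ae|//] := eqVneq a; rewrite ae group_center eqxx in ga.
  have an : a.1 != proc (h g).1 by have := noA a; rewrite aA ga eqxx.
  have -> : (a == center (proc (h g).1) g (h g).2) = false.
    by apply: contraNF an => /eqP ->.
  rewrite ga kind_centerX.
  have := unseenP hU aS ga.
  by rewrite /kind_of (negbTE an); do ![case: ifP => _].
- move=> h g /card_unused le1; rewrite cardH.
  rewrite mulrC ler_pdivrMr ?ltr0n // -natrM ler_nat [leqRHS]mulnC.
  by rewrite -[14%N]/(7 * 2)%N -mulnA leq_mul2l.
- move=> h; rewrite card_ord mulrC ler_pdivrMr ?ltr0n // -natrM ler_nat mulnC.
  by apply: card_good; rewrite -answerE.
- rewrite -natr_sum card_ord cardH mulrAC -mulrA mulrC ler_pdivlMr ?ltr0n //.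
  rewrite -!natrM ler_nat.
  apply: (@leq_trans ((\sum_g 7 * load S g) * 40)).
    by rewrite leq_mul2r /=; apply: leq_sum => g _; exact: card_seen_all.
  by rewrite -big_distrr /= sum_load; have := S_small_s; nia.
Qed.

End Coordinator.

(** * Bad inputs for small and for large [n] *)

(* Points that repeat one of [k] far-apart locations: fewer than [k] centers
   necessarily miss a location. *)
Lemma spread_instance (R : realType) (X : finType) (k : nat) :
  (0 < k)%N -> (0 < #|X|)%N ->
  exists dist : X -> X -> R, is_metric dist /\
    forall A : {set X}, (#|A| < minn k #|X|)%N ->
      (4%:E * kcenter_opt k dist <= kcenter_cost dist A)%E.
Proof.
move=> k0 X0; set m := minn k #|X|.
have m0 : (0 < m)%N by rewrite leq_min k0 X0.
pose f (x : X) : 'I_m := Ordinal (ltn_pmod (enum_rank x) m0).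
pose rep (v : 'I_m) : X := enum_val (widen_ord (geq_minr k #|X|) v).
have repK v : f (rep v) = v.
  by apply/val_inj; rewrite /= enum_valK /= modn_small.
pose nd := glue_dist f (fun _ _ _ => 1%N).
exists (fun x y => (nd x y)%:R); split; first exact: glue_dist_metric.
move=> A Am.
have [v vA] : exists v, v \notin f @: A.
  apply/existsP; rewrite -negb_forall; apply: contraL Am => /forallP all_v.
  rewrite -leqNgt; apply: leq_trans (leq_imset_card f A).
  rewrite -[leqLHS]card_ord -cardsT; apply/subset_leq_card.
  by apply/fintype.subsetP => v _; apply: all_v.
apply: (@kcenter_no_better_than_4approx _ _ _ _ [set rep u | u : 'I_m] _ (rep v)).
- apply: leq_trans (leq_imset_card _ _) _.
  by rewrite card_ord geq_minl.
- move=> x; exists (rep (f x)); first by rewrite imset_f.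
  by rewrite lern1 /nd /glue_dist repK eqxx; case: ifP.
- move=> a aA; rewrite ler_nat /nd /glue_dist repK.
  have fav : f a != v by apply: contraNneq vA => <-; rewrite imset_f.
  have [arep|_] := eqVneq a (rep v); last by rewrite (negbTE fav).
  by rewrite arep repK eqxx in fav.
Qed.

Lemma card_received (R : realType) (m n : nat) (Omega : Type)
    (alg : distributed_algorithm R m n Omega) dist w :
  #|received alg dist w| = (\sum_i #|send alg w i (local_dist dist i)|)%N.
Proof.
rewrite -sum1_card; under [RHS]eq_bigr do rewrite -sum1_card.
by rewrite pair_big_dep /=; apply: eq_bigl => x; rewrite inE.
Qed.

(** The constant is [720 = 9 * 80], for 9 processors. *)
Lemma admissible_received (R : realType) (n k : nat) (d : measure_display)
    (Omega : measurableType d) (alg : distributed_algorithm R 9 n Omega) dist w :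
  admissible 720^-1 k alg -> is_metric dist ->
  (80 * #|received alg dist w| <= n)%N.
Proof.
move=> adm /adm[few _ _ _].
have few' i : (720 * #|send alg w i (local_dist dist i)| <= n)%N.
  have := few w i; rewrite mulrC ler_pdivlMr ?ltr0n // -natrM ler_nat.
  by rewrite mulnC.
have : (\sum_i 720 * #|send alg w i (local_dist dist i)| <= 9 * n)%N.
  rewrite -[X in (X * _)%N](card_ord 9) -sum_nat_const.
  by apply: leq_sum => i _; apply: few'.
by rewrite -big_distrr /= -card_received -[720%N]/(9 * 80)%N -mulnA leq_mul2l.
Qed.

(** At most [n / 80] points are received, fewer than [k] and than [9 * n], so every outcome misses a
    location. *)
Lemma few_points_hard (R : realType) (n k : nat) (d : measure_display)
    (Omega : measurableType d) (alg : distributed_algorithm R 9 n Omega) :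
  (0 < n)%N -> (0 < k)%N -> (n < 80 * k)%N ->
  admissible 720^-1 k alg ->
  exists dist : points 9 n -> points 9 n -> R, is_metric dist /\
    forall w, (4%:E * kcenter_opt k dist <=
               kcenter_cost dist (output alg dist w))%E.
Proof.
move=> n0 k0 nk adm.
have cX : #|points 9 n| = (9 * n)%N by rewrite card_prod !card_ord.
have X0 : (0 < #|points 9 n|)%N by rewrite cX; lia.
have [dist [mdist costs]] := spread_instance R k0 X0.
exists dist; split=> // w; apply: costs.
have [_ sub _ _] := adm dist mdist.
apply: leq_ltn_trans (subset_leq_card (sub w)) _.
have := admissible_received w adm mdist.
rewrite cX; lia.
Qed.

(** Each outcome of the coins fixes a deterministic coordinator, which [hard_count] shows to solve
    few configurations; averaging then selects one configuration. *)
Lemma many_points_hard (R : realType) (n t : nat) (e : R)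
    (d : measure_display) (Omega : measurableType d) (P : probability Omega R)
    (alg : distributed_algorithm R 9 n Omega) :
  (t.+1 <= n)%N -> expR (- (t.+1%:R / 100)) <= e ->
  admissible 720^-1 (3 * t.+1) alg ->
  exists dist : points 9 n -> points 9 n -> R, is_metric dist /\
    ((1 - e)%:E <= P [set w | 4%:E * kcenter_opt (3 * t.+1) dist <=
                              kcenter_cost dist (output alg dist w)]%classic)%E.
Proof.
move=> tn ele adm.
pose config := ('I_7 * 'I_(n %/ t.+1))%type.
pose D (h : {ffun 'I_t.+1 -> config}) (x y : points 9 n) : R :=
  (hard_dist h x y)%:R.
have mD h : is_metric (D h) by exact: hard_dist_metric.
pose Q h A := (4%:E * kcenter_opt (3 * t.+1) (D h) <= kcenter_cost (D h) A)%E.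
pose S w : {set points 9 n} := finset (fun x : points 9 n => x.2 \in
  send alg w x.1 (\matrix_(j, j')
    (glue_dist (@group t n) (fun _ _ _ => 2%N) (x.1, j) (x.1, j'))%:R)).
have recE h w : received alg (D h) w = S w.
  by apply/setP => x; rewrite !inE local_hard_dist.
have outE h w : output alg (D h) w = decide alg w (S w) (restrict_dist (S w) (D h)).
  by rewrite /output recE.
have mQ h (B : set bool) :
    measurable [set w | B (Q h (output alg (D h) w))]%classic.
  have [_ _ _ mout] := adm _ (mD h).
  exact: (measurable_finite_preimage (fun A => B (Q h A)) mout).
pose E h : set Omega := [set w | ~~ Q h (output alg (D h) w)]%classic.
have mE h : measurable (E h) := mQ h (fun b => ~~ b).
have s0 : (0 < n %/ t.+1)%N by rewrite divn_gt0.
pose h0 : {ffun 'I_t.+1 -> config} := [ffun=> (ord0, Ordinal s0)].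
have [h Ph] : exists h, (P (E h) <= e%:E)%E.
  apply: exists_prob_le => // [|w].
    by apply/card_gt0P; exists h0.
  apply: (@le_trans _ _ (expR (- (t.+1%:R / 100)) *
            #|{ffun 'I_t.+1 -> config}|%:R)); last by rewrite ler_wpM2r.
  apply: le_trans (hard_count (S := S w) (dec := decide alg w (S w)) tn _ _ _).
  - apply: ler_sum => h _; rewrite indicE ler_nat.
    case: (boolP (w \in E h)) => //; rewrite inE /E /= => nQ.
    rewrite lt0b; apply: contraR nQ; rewrite negb_forall => /existsP[x].
    rewrite negb_exists => /forallP far.
    apply: (@kcenter_no_better_than_4approx _ _ _ _ (centers h) _ x).
    - exact: card_centers.
    - by move=> y; have [a ac ay] := centers_cover h y; exists a; rewrite ?lern1.
    - move=> a; rewrite outE => aA; have := far a.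
      by rewrite aA /= -leqNgt /D ler_nat.
  - by rewrite -(recE h0); apply: admissible_received adm (mD h0).
  - move=> h; have [_ sub _ _] := adm _ (mD h).
    by have := sub w; rewrite outE recE.
  - move=> h; have [_ _ card_out _] := adm _ (mD h).
    by have := card_out w; rewrite outE.
exists (D h); split=> //.
have -> : [set w | Q h (output alg (D h) w)]%classic = (~` E h)%classic.
  apply/seteqP; split=> w /=; rewrite /E /=; first by move=> Qw; rewrite Qw.
  by move=> /negP; rewrite negbK.
rewrite probability_setC // EFinB leeB //.
Qed.

(** * The number of copies, and the conclusion *)

Section Copies.
Variable R : realType.

(** One less than the number of copies; truncation yields 0 when [e >= 1], and the successor keeps
    [k] positive. *)
Definition copies (e : R) : nat := Num.truncn (100 * ln (1 / e)).

Lemma expR_copies (e : R) : 0 < e -> expR (- ((copies e).+1%:R / 100)) <= e.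
Proof.
move=> e0; rewrite -[leRHS]lnK ?posrE // ler_expR.
have := truncnS_gt (100 * ln (1 / e)).
rewrite -/(copies e) div1r lnV ?posrE //.
set u := _%:R; lra.
Qed.

Lemma centers_Theta :
  (fun e : R => (3 * (copies e).+1)%:R : R^o)
    \is 'Theta_(at_right (0 : R)) (fun e : R => ln (1 / e) : R^o).
Proof.
(* With [L = ln (1 / e)], [k] lies between [300 * L] and [300 * L + 3], which is at most [303 * L]
   once [L >= 1]. *)
rewrite qualifE; apply/asboolP; exists (300, 303) => /=.
  by rewrite !ltr0n.
near=> e.
have e0 : 0 < e by near: e; exact: nbhs_right_gt.
have e1 : e < expR (-1) by near: e; apply: nbhs_right_lt; exact: expR_gt0.
have ln1 : 1 <= ln (1 / e).
  rewrite div1r lnV ?posrE // lerNr -[leRHS]expRK ler_ln ?posrE ?expR_gt0 //.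
  exact: ltW.
have ln0 : 0 <= ln (1 / e) by apply: le_trans ln1.
rewrite normr_nat (ger0_norm ln0) natrM.
have : 0 <= 100 * ln (1 / e) by rewrite mulr_ge0.
move=> /truncn_itv /andP[]; rewrite -/(copies e) -(natr1 (copies e)).
by move=> le1 lt1; split; lra.
Unshelve. all: by end_near. Qed.

End Copies.

Theorem theorem4 (R : realType) :
  exists (c : R) (k : R -> nat),
    [/\ 0 < c,
        (fun e : R => (k e)%:R : R^o)
          \is 'Theta_(at_right (0 : R)) (fun e : R => ln (1 / e) : R^o)
      & forall e : R, 0 < e ->
        (0 < k e)%N /\
        forall (n : nat) (d : measure_display) (Omega : measurableType d)
          (P : probability Omega R) (alg : distributed_algorithm R 9 n Omega),
          (0 < n)%N ->
          admissible c (k e) alg ->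
          exists dist : points 9 n -> points 9 n -> R,
            is_metric dist /\
            ((1 - e)%:E <=
              P [set w | 4%:E * kcenter_opt (k e) dist <=
                         kcenter_cost dist (output alg dist w)]%classic)%E].
Proof.
exists 720^-1, (fun e => 3 * (copies e).+1)%N; split.
- by rewrite invr_gt0 ltr0n.
- exact: centers_Theta.
move=> e e0; split; first by rewrite muln_gt0.
move=> n d Omega P alg n0 adm.
have [tn|nt] := leqP (copies e).+1 n; first last.
  have nk : (n < 80 * (3 * (copies e).+1))%N by lia.
  have [//|dist [mdist bad]] := few_points_hard n0 _ nk adm.
  exists dist; split=> //.
  rewrite (_ : mkset _ = setT); first by rewrite probability_setT lee_fin gerBl ltW.
  by apply/seteqP; split=> // w _; exact: bad.
by apply: many_points_hard => //; exact: expR_copies.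
Qed.
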